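(* Let $\mathbb P^{\dag}$ be the probability measure obtained from $\mathbb P^\pi$ by the change of measure described in the context. Under $\mathbb P^{\dag}$, the observations $\{y_k^x\}$ are independent and identically distributed with density $\phi$, and the observations $\{y_k^q\}$ are independent and identically distributed with uniform density $\frac1{N_q}$ on $\mathcal Q$.
   Context: System. $\mathcal Q$ is a finite set of discrete states with $N_q$ elements, $X\subseteq\mathbb R^n$ is the set of continuous states, $\mathcal S=X\times\mathcal Q$ is the hybrid state space with states $s=(x,q)$, and $\mathcal U$ is a compact Borel space of control inputs. The state transition law is $\tau(ds'\mid s,u)=T_x(dx'\mid x,u,q')\,T_q(q'\mid x,q,u)$, where $T_x$ is a Borel-measurable stochastic kernel and $T_q$ a discrete transition kernel. The initial state $s_0$ has Borel-measurable density $\rho$ on $\mathcal S$. Observations. At times $k=1,\dots,N$ one observes $y_k=(y_k^x,y_k^q)\in\mathbb R^n\times\mathcal Q$, conditionally independent given the state, with $y_k^x=h(x_k,u_{k-1})+v_k$, where $h$ is bounded and continuous and the $v_k$ are i.i.d. with positive density $\phi$ on $\mathbb R^n$, and $P[y_k^q=m\mid q_k=q,u_{k-1}=u]=Q_{q,m}(u)$, assumed nowhere zero. Policies. The information vector is $i_k=(y_1,\dots,y_k,u_0,\dots,u_{k-1})$; a policy $\pi=(\mu_0,\dots,\mu_{N-1})$ consists of functions $\mu_k$ of $i_k$ with values in $\mathcal U$, and $u_k=\mu_k(i_k)$. Together with $\rho,\tau,\phi,Q$ it induces a probability measure $\mathbb P^\pi$ on state and observation trajectories. Change of measure. $\mathbb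 P^{\dag}$ is the measure determined by $d\mathbb P^\pi/d\mathbb P^{\dag}=\Lambda_k$ on the $\sigma$-algebra generated by $s_0,\dots,s_k,y_1,\dots,y_k$ (for each $k$), where $$\Lambda_k=\prod_{l=1}^k\frac{\phi(y_l^x-h(x_l,u_{l-1}))\,Q_{q_l,y_l^q}(u_{l-1})}{\phi(y_l^x)\,\frac1{N_q}}.$$ *)

(* Defs.v *)
From HB Require Import structures.
From mathcomp Require Import all_boot all_order all_algebra finmap.
From mathcomp Require Import all_classical all_reals all_analysis measurable_realfun.

Set Implicit Arguments.
Unset Strict Implicit.
Unset Printing Implicit Defensive.

Import Order.TTheory GRing.Theory Num.Theory.
Import numFieldNormedType.Exports.

Local Open Scope classical_set_scope.
Local Open Scope ring_scope.

(* Nonempty finite types; measurableType requires a default element. *)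
#[short(type="pfinType")]
HB.structure Definition PointedFinite := {T of Finite T & isPointed T}.

Notation borel T := (g_sigma_algebraType (@open T)).
Notation discrete Q := (g_sigma_algebraType [set: set Q]).

Lemma open_borel (T : ptopologicalType) (A : set T) :
  open A -> measurable (A : set (borel T)).
Proof. exact: sub_sigma_algebra. Qed.

Lemma measurable_to_borel d (S : measurableType d) (T : ptopologicalType)
    (f : S -> borel T) :
  (forall A : set T, open A -> measurable (f @^-1` A)) ->
  measurable_fun setT f.
Proof.
move=> mf; apply: (@measurability _ _ _ _ setT f (@open T : set (set (borel T)))) => //.
by move=> _ [A oA <-]; rewrite setTI; exact: mf.
Qed.

Lemma countable_dense_second_countable (R : realType) (T : pseudoMetricType R)
    (I : countType) (q : I -> T) :
  (forall x (e : R), 0 < e -> exists i, ball x e (q i)) -> @second_countable T.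
Proof.
move=> dq.
pose F (p : I * nat) : set T := (ball (q p.1) p.2.+1%:R^-1)°.
exists (range F); first exact: (sub_countable (card_image_le _ _)).
split=> [_ [p _ <-]|x V]; first exact: open_interior.
move=> /nbhs_ballP[e /= e0 xeV].
have e2 : 0 < e / 2 by rewrite divr_gt0.
have [N] := ltr_add_invr e2; rewrite add0r => Ne.
have N2 : 0 < N.+1%:R^-1 / 2 :> R by rewrite divr_gt0 ?invr_gt0.
have [i xi] := dq x _ N2.
have iN : (F (i, N)) x.
  apply/nbhs_ballP; exists (N.+1%:R^-1 / 2) => //.
  move=> z xz /=; rewrite [X in ball _ X _]splitr.
  by apply: ball_triangle xz; exact: ball_sym.
exists (F (i, N)); first by split => //; exists (i, N).
move=> z Fz; apply: xeV; rewrite [e]splitr; apply: (@ball_triangle _ _ (q i)).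
  apply: le_ball xi; rewrite (le_trans _ (ltW Ne))//.
  by rewrite ler_pdivrMr// ler_peMr ?ler1n// ltW// invr_gt0.
by apply: le_ball (ltW Ne) _ _; exact: interior_subset.
Qed.

Lemma R_second_countable (R : realType) : @second_countable R.
Proof.
apply: (@countable_dense_second_countable R R rat ratr) => x e e0.
have /rat_in_itvoo[r] : x - e < x + e by rewrite ltrBlDr -addrA ltrDl addr_gt0.
rewrite inE/= => /itvP h.
by exists r; rewrite /ball/= distrC ltr_distl !h.
Qed.

Lemma rV_second_countable (R : realType) n : @second_countable 'rV[R]_n.
Proof.
have := @countable_dense_second_countable R 'rV[R]_n 'rV[rat]_n (map_mx ratr); apply.
move=> x e e0.
have P j : exists r : rat, ball (x ord0 j) e (ratr r).
  have /rat_in_itvoo[r] : x ord0 j - e < x ord0 j + e.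
    by rewrite ltrBlDr -addrA ltrDl addr_gt0.
  rewrite inE/= => /itvP h.
  by exists r; rewrite /ball/= distrC ltr_distl !h.
have [f Hf] := choice P.
exists (\row_j f j); split => // i j.
by rewrite !mxE (ord1 i).
Qed.

Lemma open_setX_measurable d1 (S1 : measurableType d1) d2
    (S2 : measurableType d2) (T1 T2 : topologicalType) (f1 : S1 -> T1)
    (f2 : S2 -> T2) :
  @second_countable T1 -> @second_countable T2 ->
  (forall A : set T1, open A -> measurable (f1 @^-1` A)) ->
  (forall A : set T2, open A -> measurable (f2 @^-1` A)) ->
  forall O : set (T1 * T2), open O ->
  measurable [set p : S1 * S2 | O (f1 p.1, f2 p.2)].
Proof.
move=> [B1 cB1 [oB1 bB1]] [B2 cB2 [oB2 bB2]] mf1 mf2 O oO.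
pose D := [set C : set T1 * set T2 | [/\ B1 C.1, B2 C.2 & C.1 `*` C.2 `<=` O]].
pose G (C : set T1 * set T2) : set (S1 * S2) := f1 @^-1` C.1 `*` f2 @^-1` C.2.
have -> : [set p : S1 * S2 | O (f1 p.1, f2 p.2)] = \bigcup_(C in D) G C.
  apply/seteqP; split => [[a b]/= Oab|[a b] [C [_ _ CO]] [? ?]]; last exact: CO.
  have : nbhs (f1 a, f2 b) O by apply: open_nbhs_nbhs; split.
  move=> [[/= V1 V2] [/bB1[C1 [BC1 C1a] CV1] /bB2[C2 [BC2 C2b] CV2]] VO].
  exists (C1, C2) => //; split=> // -[u v] [/= ? ?]; apply: VO.
  by split; [exact: CV1|exact: CV2].
rewrite (_ : \bigcup_(C in D) G C =
    \bigcup_(C : D) G (set_val C)); last first.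
  apply/seteqP; split => [p [C DC GC]|p [C _ GC]].
    by exists (SigSub (mem_set DC)).
  by exists (set_val C) => //; exact: set_valP.
apply: countable_bigcupT_measurable => [|C].
  have cD : countable D.
    apply: (@sub_countable _ _ _ (B1 `*` B2)).
      by apply: subset_card_le => C [].
    exact: countableX.
  by rewrite (eq_countable (card_setT D)).
have [? ? _] := set_valP C.
by apply: measurableX; [apply/mf1/oB1|apply/mf2/oB2].
Qed.

Section lebesgue_rV.
Variable R : realType.

Section step.
Variables (n : nat) (m : {sigma_finite_measure set (borel 'rV[R]_n) -> \bar R}).

Definition cons_rV (p : measurableTypeR R * borel 'rV[R]_n) : borel 'rV[R]_n.+1 :=
  row_mx (p.1%:M : 'M[R]_1) (p.2 : 'rV[R]_n).

Definition head_rV (v : borel 'rV[R]_n.+1) : measurableTypeR R := (v : 'rV[R]_n.+1) ord0 ord0.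
Definition tail_rV (v : borel 'rV[R]_n.+1) : borel 'rV[R]_n :=
  rsubmx (v : 'rV[R]_(1 + n)).

Let cons_rV_cont : continuous
  (fun p : R * 'rV[R]_n => row_mx (p.1%:M : 'M[R]_1) p.2 : 'rV[R]_n.+1).
Proof.
move=> [a v] A /nbhs_ballP[e /= e0 eA].
apply/nbhs_ballP; exists e => //= -[b w] [/= ab [_ vw]]; apply: eA; split => // i j.
rewrite !mxE; case: splitP => k jk; rewrite ?mxE //=.
by rewrite !(ord1 i, ord1 k) eqxx !mulr1n.
Qed.

Lemma measurable_cons_rV : measurable_fun setT cons_rV.
Proof.
apply: measurable_to_borel => A oA.
have /continuousP/(_ _ oA) := cons_rV_cont.
by apply: (@open_setX_measurable _ (measurableTypeR R) _ (borel 'rV[R]_n) R 'rV[R]_n id id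
  (@R_second_countable R) (@rV_second_countable R n)) => // B;
  [exact: open_measurable|exact: open_borel].
Qed.

Definition lebesgue_rVS := pushforward (lebesgue_measure \x m)%E cons_rV.


Let lebesgue_rVS0 : lebesgue_rVS set0 = 0%E.
Proof. by rewrite /lebesgue_rVS /pushforward preimage_set0 measure0. Qed.

Let lebesgue_rVS_ge0 A : (0 <= lebesgue_rVS A)%E.
Proof. by rewrite /lebesgue_rVS /pushforward; exact: measure_ge0. Qed.

Let lebesgue_rVS_sigma_additive : semi_sigma_additive lebesgue_rVS.
Proof.
have mcons A : measurable A -> measurable (cons_rV @^-1` A).
  by move=> mA; rewrite -[X in measurable X]setTI; exact: measurable_cons_rV.
move=> F mF tF mUF; rewrite /lebesgue_rVS /pushforward preimage_bigcup.
apply: measure_semi_sigma_additive.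
- by move=> k; exact: mcons.
- apply/trivIsetP => /= i j _ _ ij; rewrite -preimage_setI.
  by move/trivIsetP : tF => /(_ _ _ _ _ ij) ->//; rewrite preimage_set0.
- by rewrite -preimage_bigcup; exact: mcons.
Qed.

HB.instance Definition _ := isMeasure.Build _ _ _ lebesgue_rVS
  lebesgue_rVS0 lebesgue_rVS_ge0 lebesgue_rVS_sigma_additive.

Let measurable_head_rV : measurable_fun setT head_rV.
Proof.
apply: (measurability (@RGenOpens.G R : set (set (measurableTypeR R)))).
  exact: RGenOpens.measurableE.
move=> _ [_ [x [y ->]] <-]; rewrite setTI; apply: open_borel.
have oA : open (`]x, y[%classic : set R) by exact: interval_open.
by have /continuousP/(_ _ oA) := @coord_continuous R 1 n.+1 ord0 ord0.
Qed.

Let measurable_tail_rV : measurable_fun setT tail_rV.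
Proof.
apply: measurable_to_borel => A oA; apply: open_borel.
by have /continuousP/(_ _ oA) := @continuous_rsubmx R 1 1 n.
Qed.

Lemma lebesgue_rVSE (A : set R) (B : set 'rV[R]_n) :
  measurable (A : set (measurableTypeR R)) ->
  measurable (B : set (borel 'rV[R]_n)) ->
  lebesgue_rVS [set v | A (head_rV v) /\ B (tail_rV v)] =
  (lebesgue_measure A * m B)%E.
Proof.
move=> mA mB; rewrite -product_measure1E// /lebesgue_rVS /pushforward.
congr (_ _); apply/seteqP; split => -[a v] /=;
  by rewrite /head_rV /tail_rV /cons_rV /= row_mxKr mxE;
     case: splitP => //= j _; rewrite mxE (ord1 j) eqxx mulr1n.
Qed.

Let lebesgue_rVS_sigma_finite : sigma_finite setT lebesgue_rVS.
Proof.
have /sigma_finiteP[F [FT ndF Foo]] :=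
  sigma_finiteT (@lebesgue_measure R : {sigma_finite_measure set _ -> \bar R}).
have /sigma_finiteP[G [GT ndG Goo]] := sigma_finiteT m.
exists (fun k => [set v | F k (head_rV v) /\ G k (tail_rV v)]).
  apply/seteqP; split => // v _.
  have : [set: measurableTypeR R] (head_rV v) by [].
  rewrite FT => -[i _ Fi].
  have : [set: borel 'rV[R]_n] (tail_rV v) by [].
  rewrite GT => -[j _ Gj].
  exists (maxn i j) => //=; split.
    by have /subsetPset := ndF _ _ (leq_maxl i j); exact.
  by have /subsetPset := ndG _ _ (leq_maxr i j); exact.
move=> k; have [mF Fk] := Foo k; have [mG Gk] := Goo k; split.
  apply: measurableI.
    by rewrite -[X in measurable X]setTI; exact: measurable_head_rV.
  by rewrite -[X in measurable X]setTI; exact: measurable_tail_rV.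
by rewrite lebesgue_rVSE// lte_mul_pinfty// ge0_fin_numE.
Qed.

HB.instance Definition _ := @Measure_isSigmaFinite.Build _ _ _ lebesgue_rVS
  lebesgue_rVS_sigma_finite.

End step.

(* Lebesgue measure on R^n, as an iterated product of the one-dimensional
   measure; lebesgue_rV_box below computes it on boxes. *)
Fixpoint lebesgue_rV n : {sigma_finite_measure set (borel 'rV[R]_n) -> \bar R} :=
  match n with
  | 0 => dirac (0 : borel 'rV[R]_0)
  | k.+1 => lebesgue_rVS (lebesgue_rV k)
  end.

Lemma lebesgue_rV_box n (a b : 'rV[R]_n) : (forall i, a ord0 i <= b ord0 i) ->
  lebesgue_rV n [set v : 'rV[R]_n | forall i, a ord0 i <= v ord0 i <= b ord0 i] =
  (\prod_(i < n) (b ord0 i - a ord0 i))%:E.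
Proof.
elim: n a b => [|n IH] a b ab.
  rewrite big_ord0 /= diracE (_ : _ \in _ = true)//; apply/mem_set.
  by move=> [].
rewrite big_ord_recl EFinM.
pose a' : 'rV[R]_n := rsubmx (a : 'rV_(1 + n)).
pose b' : 'rV[R]_n := rsubmx (b : 'rV_(1 + n)).
have tailE (v : 'rV[R]_n.+1) i : (tail_rV v : 'rV[R]_n) ord0 i = v ord0 (lift ord0 i).
  by rewrite !mxE; congr (v _ _); exact: val_inj.
have a'E i : a' ord0 i = a ord0 (lift ord0 i) by exact: tailE.
have b'E i : b' ord0 i = b ord0 (lift ord0 i) by exact: tailE.
pose A : set R := `[a ord0 ord0, b ord0 ord0]%classic.
pose B := [set w : 'rV[R]_n | forall i, a' ord0 i <= w ord0 i <= b' ord0 i].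
rewrite (_ : [set v : 'rV[R]_n.+1 | _] =
  [set v : borel 'rV[R]_n.+1 | A (head_rV v) /\ B (tail_rV v)]); last first.
  apply/seteqP; split => v /=.
    move=> H; split; first by rewrite /A /= in_itv/= H.
    by move=> i; rewrite tailE a'E b'E.
  rewrite /A /= in_itv/= => -[H0 H] i.
  have [j ->|->//] := unliftP ord0 i.
  by have := H j; rewrite tailE a'E b'E.
rewrite /= lebesgue_rVSE//; first last.
- rewrite (_ : B = \bigcap_(i in [set: 'I_n])
   ((fun w : borel 'rV[R]_n => (w : 'rV[R]_n) ord0 i) @^-1`
    `[a' ord0 i, b' ord0 i]%classic)); last first.
    apply/seteqP; split => w /= H i; first by move=> _ /=; rewrite in_itv/= H.
    by have := H i I; rewrite /= in_itv.
  apply: fin_bigcap_measurable => // i _.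
  set I := `[_, _]%classic.
  have cI : closed (I : set R) by exact: interval_closed.
  rewrite -[X in measurable X]setCK; apply: measurableC; apply: open_borel.
  rewrite openC.
  by have /continuous_closedP/(_ _ cI) := @coord_continuous R 1 n ord0 i.
- exact: measurable_itv.
rewrite IH; last by move=> i; rewrite a'E b'E.
congr (_ * _)%E; last by congr _%:E; apply: eq_bigr => i _; rewrite a'E b'E.
rewrite lebesgue_measure_itv/= lte_fin.
by case: ltgtP (ab ord0) => //= -> _; rewrite subrr.
Qed.

End lebesgue_rV.

(* A Borel space is a topological space homeomorphic to a Borel subset of a
   complete separable metric space. *)
Definition borel_space (R : realType) (T : topologicalType) : Prop :=
  exists (P : completePseudoMetricType R) (f : T -> P),
    [/\ hausdorff_space P,
        exists2 D : set P, countable D & dense D,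
        injective f,
        forall A : set T, open A <-> exists2 B : set P, open B & A = f @^-1` B
      & measurable (range f : set (borel P))].

Section probability_notions.
Local Open Scope ereal_scope.
Context d (Omega : measurableType d) (R : realType).
Implicit Types P : probability Omega R.

(* g is a version of P(E | G), provided that g is G-measurable, as it is in
   every use below. *)
Definition is_cond_prob P (G : set (set Omega)) (E : set Omega)
    (g : Omega -> \bar R) : Prop :=
  forall A, G A -> P (A `&` E) = \int[P]_(w in A) g w.

Definition mutually_independent P d' (T : measurableType d') (D : set nat)
    (Y : nat -> Omega -> T) : Prop :=
  forall J : {fset nat}, [set` J] `<=` D ->
  forall B : nat -> set T, (forall i, measurable (B i)) ->
    P (\bigcap_(i in [set` J]) (Y i @^-1` B i)) =
    \prod_(i <- J) P (Y i @^-1` B i).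

Definition iid_with_law P d' (T : measurableType d') (D : set nat)
    (Y : nat -> Omega -> T) (law : set T -> \bar R) : Prop :=
  mutually_independent P D Y /\
  forall i, D i -> forall B, measurable B -> P (Y i @^-1` B) = law B.

End probability_notions.

Section hybrid_system.
Variables (R : realType) (n : nat) (Q : pfinType) (U : ptopologicalType).

Local Notation Rn := (borel 'rV[R]_n).
Local Notation DQ := (discrete Q).
Local Notation BU := (borel U).

(* Data indexed by X are given on all of R^n, but constrained on X only. The
   arguments of sys_Tx are (x, u, q'), those of sys_Tq are (x, q, u), and
   sys_Qobs q m u is Q_{q,m}(u). *)
Record hybrid_system := HybridSystem {
  sys_X : set Rn ;
  sys_Tx : R.-pker (Rn * BU * DQ)%type ~> Rn ;
  sys_Tq : R.-pker (Rn * DQ * BU)%type ~> DQ ;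
  sys_rho : Rn * DQ -> R ;
  sys_h : 'rV[R]_n * U -> 'rV[R]_n ;
  sys_phi : Rn -> R ;
  sys_Qobs : Q -> Q -> BU -> R ;
  sys_X_measurable : measurable sys_X ;
  sys_Tx_X : forall x u q', sys_X x -> sys_Tx (x, u, q') sys_X = 1%E ;
  sys_rho_measurable : measurable_fun (sys_X `*` setT) sys_rho ;
  sys_rho_ge0 : forall x q, sys_X x -> 0 <= sys_rho (x, q) ;
  sys_rho_total : (\sum_(q : Q) \int[lebesgue_rV R n]_(x in sys_X)
         (sys_rho (x, q))%:E)%E = 1%E ;
  sys_h_continuous : {within sys_X `*` [set: U], continuous sys_h} ;
  sys_h_bounded : exists M : R, forall x u, sys_X x -> `|sys_h (x, u)| <= M ;
  sys_phi_measurable : measurable_fun setT sys_phi ;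
  sys_phi_gt0 : forall z, 0 < sys_phi z ;
  sys_phi_total : (\int[lebesgue_rV R n]_z (sys_phi z)%:E)%E = 1%E ;
  sys_Qobs_measurable : forall q m, measurable_fun setT (sys_Qobs q m) ;
  sys_Qobs_gt0 : forall q m u, 0 < sys_Qobs q m u ;
  sys_Qobs_total : forall q u, \sum_(m : Q) sys_Qobs q m u = 1
}.

(* Law with density rho with respect to Lebesgue measure on X times the
   counting measure on Q. *)
Definition init_law (S : hybrid_system) (D : set (Rn * DQ)) : \bar R :=
  (\sum_(q : Q) \int[lebesgue_rV R n]_(x in sys_X S `&` [set x | D (x, q)])
     (sys_rho S (x, q))%:E)%E.

(* tau(ds'|s,u) = T_x(dx'|x,u,q') T_q(q'|x,q,u) *)
Definition transition_law (S : hybrid_system) (s : Rn * DQ) (a : BU)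
    (D : set (Rn * DQ)) : \bar R :=
  (\sum_(q' : Q) sys_Tx S (s.1, a, q') [set x' | D (x', q')] *
                 sys_Tq S (s.1, s.2, a) [set q'])%E.

Definition noise_law (S : hybrid_system) (C : set Rn) : \bar R :=
  (\int[lebesgue_rV R n]_(z in C) (sys_phi S z)%:E)%E.

Definition uniform_law (C : set DQ) : \bar R :=
  (\sum_(m : Q | (m : DQ) \in C) (#|Q|%:R^-1)%:E)%E.

Section trajectories.
Context d (Omega : measurableType d).
Variables (s y : nat -> Omega -> Rn * DQ) (u : nat -> Omega -> BU).

(* i_k = (y_1, ..., y_k, u_0, ..., u_{k-1}) *)
Definition information (k : nat) (w : Omega) :
    k.-tuple (Rn * DQ) * k.-tuple BU :=
  ([tuple y i.+1 w | i < k], [tuple u i w | i < k]).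

(* The sigma-algebra generated by s_0, ..., s_k, y_1, ..., y_l *)
Definition history (k l : nat) : set (set Omega) :=
  <<s [set E | (exists j B, [/\ (j <= k)%N, measurable B & E = s j @^-1` B]) \/
               (exists j B, [/\ (1 <= j <= l)%N, measurable B
                              & E = y j @^-1` B])] >>.

Definition likelihood (S : hybrid_system) (k : nat) (w : Omega) : R :=
  \prod_(1 <= l < k.+1)
    ((sys_phi S ((y l w).1 - sys_h S ((s l w).1, u l.-1 w) : 'rV[R]_n) *
      sys_Qobs S (s l w).2 (y l w).2 (u l.-1 w)) /
     (sys_phi S (y l w).1 * #|Q|%:R^-1)).

(* P is the measure induced on trajectories up to time N by the policy mu,
   realised on an arbitrary sample space. Given the past and the current state,
   the noise v_{k+1} has density phi and is independent of y^q_{k+1}. *)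
Record closed_loop (S : hybrid_system) (N : nat)
    (mu : forall k, k.-tuple (Rn * DQ) * k.-tuple BU -> BU)
    (v : nat -> Omega -> Rn) (P : probability Omega R) : Prop := ClosedLoop {
  loop_s_measurable : forall k, (k <= N)%N -> measurable_fun setT (s k) ;
  loop_y_measurable : forall k, (1 <= k <= N)%N -> measurable_fun setT (y k) ;
  loop_v_measurable : forall k, (1 <= k <= N)%N -> measurable_fun setT (v k) ;
  loop_s_in_X : forall k w, (k <= N)%N -> sys_X S (s k w).1 ;
  loop_control : forall k w, (k < N)%N -> u k w = mu k (information k w) ;
  loop_init : forall D, measurable D -> P (s 0 @^-1` D) = init_law S D ;
  loop_transition : forall k, (k < N)%N -> forall D, measurable D ->
      is_cond_prob P (history k k) (s k.+1 @^-1` D)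
        (fun w => transition_law S (s k w) (u k w) D) ;
  loop_obs_x : forall k w, (k < N)%N ->
      (y k.+1 w).1 = sys_h S ((s k.+1 w).1, u k w) + (v k.+1 w : 'rV[R]_n) ;
  loop_noise : forall k, (k < N)%N -> forall C (m : Q), measurable C ->
      is_cond_prob P (history k.+1 k)
        (v k.+1 @^-1` C `&` [set w | (y k.+1 w).2 = m])
        (fun w => noise_law S C * (sys_Qobs S (s k.+1 w).2 m (u k w))%:E)%E
}.

(* dP/dPd = likelihood k on the sigma-algebra history k k *)
Definition change_of_measure (S : hybrid_system) (N : nat)
    (P Pd : probability Omega R) : Prop :=
  forall k, (k <= N)%N -> forall A, history k k A ->
    P A = (\int[Pd]_(w in A) (likelihood S k w)%:E)%E.

End trajectories.
End hybrid_system.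

(* Main.v *)
Require Import Defs.
From HB Require Import structures.
From mathcomp Require Import all_boot all_order all_algebra finmap.
From mathcomp Require Import all_classical all_reals all_analysis.
From mathcomp Require Import measurable_realfun.

Set Implicit Arguments.
Unset Strict Implicit.
Unset Printing Implicit Defensive.

Import Order.TTheory GRing.Theory Num.Theory.
Import numFieldNormedType.Exports.

Local Open Scope classical_set_scope.
Local Open Scope ring_scope.

(* The weight Lambda_k is positive, so Pd has density 1/Lambda_k with respect to
   P on the history up to time k. Given the history and the next state, the
   pair (v_{k+1}, y^q_{k+1}) has under P the density phi * Q, which the last
   factor of 1/Lambda_{k+1} replaces by phi(h + z) / N_q; translation invariance
   of the Lebesgue measure then removes h. Hence under Pd the next observation
   has law phi dz times the uniform law and is independent of the history, and
   independence of all observations follows by induction on time. *)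

(** * Integration against image measures and densities *)

Section density.
Local Open Scope ereal_scope.
Context d1 d2 d (T1 : measurableType d1) (T2 : measurableType d2)
  (X : measurableType d) (R : realType).
Variables (m1 : {measure set T1 -> \bar R}) (m2 : {measure set T2 -> \bar R}).
Variables (D : set T1) (a : T1 -> X) (b : T2 -> X) (f : T2 -> R).
Hypotheses (mD : measurable D) (ma : measurable_fun setT a)
  (mb : measurable_fun setT b) (mf : measurable_fun setT f)
  (f0 : forall x, (0 <= f x)%R).
Hypothesis m12 : forall A, measurable A ->
  m1 (D `&` a @^-1` A) = \int[m2]_(x in b @^-1` A) (f x)%:E.

Import HBNNSimple.

(** By [m12], the image under [a] of [m1] restricted to [D] and the image under [b] of the measure
    with density [f] with respect to [m2] agree on [X]. The equality passes from level sets to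
    simple functions by linearity, then to [g] by monotone convergence. [X] may carry a coarser
    sigma-algebra than the two domains, so [a] and [b] can be identity maps into a history. *)
Lemma ge0_integral_density (g : X -> \bar R) :
  measurable_fun setT g -> (forall x, 0 <= g x) ->
  \int[m1]_(x in D) g (a x) = \int[m2]_x (g (b x) * (f x)%:E).
Proof.
move=> mg g0; pose g_ := nnsfun_approx measurableT mg.
have g_a n : measurable_fun setT (fun x => (g_ n (a x))%:E).
  by apply/measurable_EFinP; apply: measurableT_comp.
have g_b n : measurable_fun setT (fun x => (g_ n (b x))%:E).
  by apply/measurable_EFinP; apply: measurableT_comp.
have g_g x : EFin \o g_ ^~ x @ \oo --> g x.
  by apply: cvg_nnsfun_approx.
have mfE : measurable_fun setT (EFin \o f) by exact/measurable_EFinP.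
transitivity (limn (fun n => \int[m1]_(x in D) (g_ n (a x))%:E)).
  rewrite -monotone_convergence//.
  - by apply: eq_integral => x _; apply/esym/cvg_lim => //; exact: g_g.
  - by move=> n; exact: measurable_funTS.
  - by move=> n x _; rewrite lee_fin.
  - by move=> x _ i j ij; rewrite lee_fin; exact/lefP/nd_nnsfun_approx.
transitivity (limn (fun n => \int[m2]_x ((g_ n (b x))%:E * (f x)%:E)));
  last first.
  rewrite -monotone_convergence//.
  - apply: eq_integral => x _; apply/cvg_lim => //.
    by apply: cvgeZr => //; exact: g_g.
  - by move=> n; exact: emeasurable_funM.
  - by move=> n x _; rewrite mule_ge0// lee_fin.
  - move=> x _ i j ij; rewrite lee_wpmul2r// lee_fin//.
    exact/lefP/nd_nnsfun_approx.
(* Each approximation [g_ n] is a finite combination of indicators of its level sets, and [m12]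
   applies to the preimage of each of them. *)
congr (limn _); apply/funext => n.
have mA r : measurable (a @^-1` (g_ n @^-1` [set r])).
  by rewrite -[X in measurable X]setTI; exact: ma.
have mB r : measurable (b @^-1` (g_ n @^-1` [set r])).
  by rewrite -[X in measurable X]setTI; exact: mb.
have mindA r : measurable_fun setT (\1_(g_ n @^-1` [set r]) \o a : T1 -> R).
  by apply: measurableT_comp.
have mindB r : measurable_fun setT (\1_(g_ n @^-1` [set r]) \o b : T2 -> R).
  by apply: measurableT_comp.
transitivity (\int[m1]_(x in D) \sum_(r \in range (g_ n))
    (r * \1_(g_ n @^-1` [set r]) (a x))%:E).
  by apply: eq_integral => x _; rewrite fimfunE -fsumEFin.
transitivity (\int[m2]_x \sum_(r \in range (g_ n))
    ((r * \1_(g_ n @^-1` [set r]) (b x))%:E * (f x)%:E)); last first.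
  apply: eq_integral => x _; rewrite -ge0_mule_fsuml.
    by rewrite fsumEFin// -fimfunE.
  by move=> r; rewrite EFinM nnfun_muleindic_ge0.
rewrite !ge0_integral_fsum//.
- apply: eq_fsbigr => r /[!inE] -[z _ gzr].
  have r0 : (0 <= r)%R by rewrite -gzr.
  under eq_integral do rewrite EFinM.
  under [RHS]eq_integral do rewrite EFinM -muleA.
  rewrite !ge0_integralZl//; first last.
  - by apply/measurable_funTS/measurable_EFinP; exact: mindA.
  - by move=> x _; rewrite mule_ge0 ?lee_fin.
  - by apply: emeasurable_funM => //; apply/measurable_EFinP; exact: mindB.
  congr (_ * _).
  rewrite [LHS](@integral_indic _ _ _ m1 D mD (a @^-1` (g_ n @^-1` [set r])))//.
  rewrite setIC m12// [LHS]integral_mkcond; apply: eq_integral => x _.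
  rewrite patchE indicE muleC.
  have -> : (x \in b @^-1` (g_ n @^-1` [set r])) = (b x \in g_ n @^-1` [set r]).
    by [].
  by case: ifPn => xr; rewrite ?mule1 ?mule0.
- move=> r; apply: emeasurable_funM => //; apply/measurable_EFinP.
  by apply: measurable_funM => //; exact: mindB.
- by move=> r x _; rewrite mule_ge0 ?lee_fin// -lee_fin EFinM nnfun_muleindic_ge0.
- move=> r; apply/measurable_funTS/measurable_EFinP.
  by apply: measurable_funM => //; exact: mindA.
- by move=> r x _; rewrite EFinM nnfun_muleindic_ge0.
Qed.

End density.

Section image_density.
Local Open Scope ereal_scope.
Context d d' (T : measurableType d) (X : measurableType d') (R : realType).
Variables (m : {measure set T -> \bar R}) (b : T -> X) (f : T -> R).

(* The proofs are arguments so that the measure instance can be inferred. *)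
Definition image_density of measurable_fun setT b & measurable_fun setT f &
  (forall x, (0 <= f x)%R) := fun A : set X => \int[m]_(x in b @^-1` A) (f x)%:E.

Variables (mb : measurable_fun setT b) (mf : measurable_fun setT f)
  (f0 : forall x, (0 <= f x)%R).
Local Notation nu := (image_density mb mf f0).

Let nu0 : nu set0 = 0.
Proof. by rewrite /image_density preimage_set0 integral_set0. Qed.

Let nu_ge0 A : 0 <= nu A.
Proof. by apply: integral_ge0 => x _; rewrite lee_fin. Qed.

Let nu_sigma_additive : semi_sigma_additive nu.
Proof.
have mb' A : measurable A -> measurable (b @^-1` A).
  by move=> mA; rewrite -[X in measurable X]setTI; exact: mb.
move=> F mF tF mUF; rewrite /image_density preimage_bigcup.
apply: semi_sigma_additive_nng_induced => //.
- exact/measurable_EFinP.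
- by move=> i; exact: mb'.
- apply/trivIsetP => i j _ _ ij; rewrite -preimage_setI.
  by move/trivIsetP : tF => /(_ _ _ _ _ ij) ->//; rewrite preimage_set0.
- by rewrite -preimage_bigcup; exact: mb'.
Qed.

HB.instance Definition _ := isMeasure.Build _ _ _ nu nu0 nu_ge0 nu_sigma_additive.

End image_density.

(** * Joint law of the past and the noise, from its values on rectangles *)

Section disintegration.
Local Open Scope ereal_scope.
Context d dX dZ (Omega : measurableType d) (X : measurableType dX)
  (Z : measurableType dZ) (R : realType).
Variables (P : probability Omega R) (l : {sigma_finite_measure set Z -> \bar R}).
Variables (xi : Omega -> X) (zeta : Omega -> Z) (E : set Omega) (q : Omega -> R)
  (phi : Z -> R).
Hypotheses (mxi : measurable_fun setT xi) (mzeta : measurable_fun setT zeta)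
  (mE : measurable E) (mq : measurable_fun setT q)
  (mphi : measurable_fun setT phi).
Hypotheses (q0 : forall w, (0 <= q w)%R) (phi0 : forall z, (0 <= phi z)%R).
Hypothesis law_rect : forall A C, measurable A -> measurable C ->
  P (xi @^-1` A `&` (zeta @^-1` C `&` E)) =
  \int[P]_(w in xi @^-1` A) ((\int[l]_(z in C) (phi z)%:E) * (q w)%:E).

Let dens (p : Omega * Z) := (phi p.2 * q p.1)%R.
Let joint w := (xi w, zeta w).
Let base (p : Omega * Z) := (xi p.1, p.2).

Let mdens : measurable_fun setT dens.
Proof. by apply: measurable_funM; exact: measurableT_comp. Qed.

Let mjoint : measurable_fun setT joint.
Proof. exact: measurable_fun_pair. Qed.

Let mbase : measurable_fun setT base.
Proof. by apply: measurable_fun_pair => //; exact: measurableT_comp. Qed.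

Let dens0 p : (0 <= dens p)%R. Proof. exact: mulr_ge0. Qed.

Let dens_rect A C : measurable A -> measurable C ->
  \int[P \x l]_(p in base @^-1` (A `*` C)) (dens p)%:E =
  \int[P]_(w in xi @^-1` A) ((\int[l]_(z in C) (phi z)%:E) * (q w)%:E).
Proof.
move=> mA mC.
have mAC : measurable (base @^-1` (A `*` C)).
  by rewrite -[X in measurable X]setTI; apply: mbase => //; exact: measurableX.
rewrite integral_mkcond fubini_tonelli1//; last 2 first.
- apply/(measurable_restrictT _ _).1 => //.
  by apply/measurable_funTS/measurable_EFinP.
- by apply: erestrict_ge0 => p _; rewrite lee_fin.
rewrite [RHS]integral_mkcond; apply: eq_integral => w _.
rewrite /fubini_F patchE; case: ifPn => wA.
  rewrite -ge0_integralZr ?lee_fin//; last 2 first.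
  - by apply/measurable_funTS/measurable_EFinP.
  - by move=> z _; rewrite lee_fin.
  rewrite [RHS]integral_mkcond; apply: eq_integral => z _.
  rewrite !patchE /dens /= EFinM.
  have -> // : ((w, z) \in base @^-1` (A `*` C)) = (z \in C).
  apply/idP/idP; rewrite !inE; first by case.
  by move: wA; rewrite inE.
rewrite integral0_eq// => z _; rewrite patchE ifF//.
apply: contraNF wA; rewrite !inE; by case.
Qed.

(** [law_rect] gives the law of [(xi, zeta)] on [E] for rectangles only. Rectangles form a
    generating class stable under intersection, so this law is the image under [base] of the measure
    with density [phi z * q w] with respect to [P \x l]. [ge0_integral_density] and Tonelli then
    give the iterated integral. *)
Lemma integral_disintegration (F : X * Z -> \bar R) :
  measurable_fun setT F -> (forall p, 0 <= F p) ->
  \int[P]_(w in E) F (xi w, zeta w) =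
  \int[P]_w \int[l]_z (F (xi w, z) * (phi z * q w)%:E).
Proof.
move=> mF F0.
pose ind : Omega -> R := \1_E.
have mind : measurable_fun setT ind by exact: measurable_indic.
have ind0 w : (0 <= ind w)%R by rewrite /ind indicE.
have jointE A : measurable A ->
    P (E `&` joint @^-1` A) = image_density P mjoint mind ind0 A.
  move=> mA; have mjA : measurable (joint @^-1` A).
    by rewrite -[X in measurable X]setTI; exact: mjoint.
  by rewrite /image_density integral_indic.
have key A : measurable A -> P (E `&` joint @^-1` A) =
    image_density (P \x l) mbase mdens dens0 A.
  move=> mA; rewrite jointE//.
  (* The mass is at most [P E], hence finite, so the constant sequence [setT] serves as the
     exhaustion. *)
  apply: (measure_unique [set A `*` B | A in measurable & B in measurable]
    (fun _ => setT)) => //.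
  - by rewrite measurable_prod_measurableType.
  - move=> _ _ [A1 mA1 [A2 mA2 <-]] [B1 mB1 [B2 mB2 <-]].
    exists (A1 `&` B1); first exact: measurableI.
    by exists (A2 `&` B2); [exact: measurableI|rewrite setXI].
  - by move=> _; exists setT => //; exists setT => //; rewrite setXTT.
  - by rewrite bigcup_const//; exists 0%N.
  - move=> _ [A1 mA1 [C1 mC1 <-]].
    transitivity (P (E `&` joint @^-1` (A1 `*` C1))).
      by rewrite jointE//; exact: measurableX.
    rewrite [RHS]dens_rect// -law_rect//; congr (P _).
    by apply/seteqP; split => w /=; tauto.
  - move=> _; rewrite (_ : _ setT = P (E `&` joint @^-1` setT)); last by rewrite jointE.
    by rewrite preimage_setT setIT (le_lt_trans (probability_le1 P mE))// ltry.
rewrite (@ge0_integral_density _ _ _ _ _ _ _ P (P \x l) E joint base dens)//.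
rewrite fubini_tonelli1//.
- apply: emeasurable_funM; last exact/measurable_EFinP.
  exact: measurableT_comp.
- by move=> p; rewrite mule_ge0// lee_fin.
Qed.

End disintegration.

Lemma measurable_pair_continuous d (T : measurableType d)
    (T1 T2 T3 : ptopologicalType) (F : T1 * T2 -> T3) (f : T -> borel T1)
    (g : T -> borel T2) :
  @second_countable T1 -> @second_countable T2 -> continuous F ->
  measurable_fun setT f -> measurable_fun setT g ->
  measurable_fun setT (fun t => F (f t, g t) : borel T3).
Proof.
move=> c1 c2 cF mf mg; apply: measurable_to_borel => O oO.
have mO := @open_setX_measurable _ (borel T1) _ (borel T2) _ _ id id c1 c2
  (@open_borel T1) (@open_borel T2) (F @^-1` O) ((continuousP F).1 cF _ oO).
rewrite -[X in measurable X]setTI.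
exact: (measurable_fun_pair mf mg measurableT mO).
Qed.

Lemma measurable_addrV (R : realType) n d (T : measurableType d)
    (f g : T -> borel 'rV[R]_n) :
  measurable_fun setT f -> measurable_fun setT g ->
  measurable_fun setT
    (fun t => (f t : 'rV[R]_n) + (g t : 'rV[R]_n) : borel 'rV[R]_n).
Proof.
move=> mf mg; apply: (@measurable_pair_continuous _ _ 'rV[R]_n 'rV[R]_n
  'rV[R]_n (fun p => p.1 + p.2)) => //; try exact: rV_second_countable.
exact: add_continuous.
Qed.

Lemma measurable_subrV (R : realType) n d (T : measurableType d)
    (f g : T -> borel 'rV[R]_n) :
  measurable_fun setT f -> measurable_fun setT g ->
  measurable_fun setT
    (fun t => (f t : 'rV[R]_n) - (g t : 'rV[R]_n) : borel 'rV[R]_n).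
Proof.
move=> mf mg; apply: (@measurable_pair_continuous _ _ 'rV[R]_n 'rV[R]_n
  'rV[R]_n (fun p => p.1 - p.2)) => //; try exact: rV_second_countable.
exact: sub_continuous.
Qed.

(** * Translation invariance of the Lebesgue measure *)

Section translation.
Variable R : realType.
Local Open Scope ereal_scope.

Let mshift n (h : 'rV[R]_n) : measurable_fun setT
  (fun z : borel 'rV[R]_n => (h + (z : 'rV[R]_n))%R : borel 'rV[R]_n).
Proof. by apply: (@measurable_addrV _ _ _ _ (fun=> h) id). Qed.

(** A translation preserves the length of the intervals []a, b]], and these values determine the
    Lebesgue measure. *)
Lemma lebesgue_measure_shift (x : R) (A : set (measurableTypeR R)) :
  measurable A ->
  lebesgue_measure
    ((fun z : measurableTypeR R => (x + z)%R : measurableTypeR R) @^-1` A) =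
  lebesgue_measure A.
Proof.
move=> mA; pose s : measurableTypeR R -> measurableTypeR R := fun z => (x + z)%R.
have ms : measurable_fun setT s by apply: measurable_funD.
apply/esym; apply: (@lebesgue_measure_unique R (pushforward lebesgue_measure s)) => //.
move=> _ [[a b] _ <-].
have sab : s @^-1` `]a, b]%classic = `](a - x)%R, (b - x)%R]%classic.
  by apply/seteqP; split => z; rewrite /s /= !in_itv /= ltrBlDl lerBrDl.
rewrite /pushforward /= [X in _ = lebesgue_measure X]sab !lebesgue_measure_itv/= !lte_fin.
rewrite ltrD2r; case: ifP => // _.
by rewrite -!EFinB opprB addrA subrK.
Qed.

Let shift n (h : 'rV[R]_n) (z : borel 'rV[R]_n) : borel 'rV[R]_n :=
  (h + (z : 'rV[R]_n))%R.

Let shift_cons_rV n (h : 'rV[R]_n.+1) (p : measurableTypeR R * borel 'rV[R]_n) :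
  shift h (cons_rV p) =
  cons_rV ((h ord0 ord0 + p.1)%R : measurableTypeR R, shift (tail_rV h) p.2).
Proof.
apply/rowP => i; rewrite !mxE; case: splitP => j ij.
  rewrite !mxE (ord1 j) /= !mulr1n; congr (h _ _ + _)%R.
  by apply/val_inj; rewrite /= ij (ord1 j).
by rewrite !mxE; congr (h _ _ + _)%R; exact: val_inj.
Qed.

(** Through [cons_rV], a translation acts separately on the head and on the tail. It thus preserves
    the product measure of rectangles, and these values determine the product measure. *)
Let lebesgue_rVS_shift n
    (m : {sigma_finite_measure set (borel 'rV[R]_n) -> \bar R})
    (h : 'rV[R]_n.+1) :
  (forall h' (A : set (borel 'rV[R]_n)), measurable A ->
    m (shift h' @^-1` A) = m A) ->
  forall A : set (borel 'rV[R]_n.+1), measurable A ->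
  lebesgue_rVS m (shift h @^-1` A) = lebesgue_rVS m A.
Proof.
move=> mS A mA.
pose sh (p : measurableTypeR R * borel 'rV[R]_n) :
    measurableTypeR R * borel 'rV[R]_n := ((h ord0 ord0 + p.1)%R, shift (tail_rV h) p.2).
have msh : measurable_fun setT sh.
  apply: measurable_fun_pair; first exact: measurable_funD.
  by apply: (@measurable_addrV _ _ _ _ (fun=> tail_rV h) snd).
have mcA : measurable (@cons_rV R n @^-1` A).
  by rewrite -[X in measurable X]setTI; exact: measurable_cons_rV.
rewrite /lebesgue_rVS /pushforward.
have -> : @cons_rV R n @^-1` (shift h @^-1` A) = sh @^-1` (@cons_rV R n @^-1` A).
  apply/seteqP; split => p; rewrite /preimage /mkset.
    by rewrite shift_cons_rV.
  by rewrite shift_cons_rV.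
apply/esym; apply: (@product_measure_unique _ _ _ _ R lebesgue_measure
  m (pushforward (lebesgue_measure \x m) sh)) => // B C mB mC.
transitivity ((lebesgue_measure \x m)%E
  ((fun z : measurableTypeR R => (h ord0 ord0 + z)%R : measurableTypeR R) @^-1` B `*`
  (shift (tail_rV h) @^-1` C))); first by [].
rewrite product_measure1E//.
- by congr (_ * _); [exact: lebesgue_measure_shift|exact: mS].
- by rewrite -[X in measurable X]setTI; apply: (measurable_funD (f:=fun=> _) (g:=id)).
- by rewrite -[X in measurable X]setTI; exact: mshift.
Qed.

(** Induction on the dimension: in dimension 0 there is a single vector and the translation is the
    identity; [lebesgue_rVS_shift] adds one coordinate. *)
Lemma lebesgue_rV_shift n (h : 'rV[R]_n) (A : set (borel 'rV[R]_n)) :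
  measurable A ->
  lebesgue_rV R n ((fun z : borel 'rV[R]_n =>
    (h + (z : 'rV[R]_n))%R : borel 'rV[R]_n) @^-1` A) =
  lebesgue_rV R n A.
Proof.
elim: n h A => [|n IH] h A mA.
  rewrite (_ : (fun z : borel 'rV[R]_0 => _) = id)//.
  by apply/funext => z; apply/rowP => -[].
exact: (lebesgue_rVS_shift (m := lebesgue_rV R n)).
Qed.

Lemma ge0_integral_shift n (h : 'rV[R]_n) (g : borel 'rV[R]_n -> \bar R) :
  measurable_fun setT g -> (forall z, 0 <= g z) ->
  \int[lebesgue_rV R n]_z g (h + (z : 'rV[R]_n))%R =
  \int[lebesgue_rV R n]_z g z.
Proof.
move=> mg g0.
rewrite (ge0_integral_density (m2 := lebesgue_rV R n) (b := id)
  (f := cst 1%R) measurableT (mshift h))//.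
- by apply: eq_integral => z _; rewrite mule1.
- by move=> A mA; rewrite setTI [RHS](integral_cst _ mA 1) mul1e; exact: lebesgue_rV_shift.
Qed.

End translation.

(** The countable dense set gives the metric space a countable base, and [T], whose open sets are
    the preimages of open sets under [f], inherits the preimages of that base. *)
Lemma borel_space_second_countable (R : realType) (T : ptopologicalType) :
  borel_space R T -> @second_countable T.
Proof.
move=> [P [f [_ [D cD dD] _ fO _]]].
have D0 : D !=set0.
  by have [p [_ Dp]] := dD setT (ex_intro _ (f point) I) openT; exists p.
(* [D] is countable and nonempty, hence enumerated by a surjection [g] from [nat]. *)
have [/eqP|[g]] := pfcard_geP cD; first by move/set0P: D0 => /negP.
have [B cB [oB bB]] : @second_countable P.
  apply: (@countable_dense_second_countable R P nat g) => p e e0.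
  have [|x [pex Dx]] := dD (ball p e)° _ (@open_interior _ _).
    by exists p; exact: nbhsx_ballx.
  have [k _ gk] := @surj _ _ _ _ g x Dx.
  by exists k; rewrite gk; exact: interior_subset.
exists [set f @^-1` b | b in B]; first exact: (sub_countable (card_image_le _ _)).
split=> [_ [b Bb <-]|t V].
  by apply/fO; exists b => //; exact: oB.
rewrite nbhsE => -[W [oW Wt] WV].
have [b ob Wb] := (fO W).1 oW.
have [|c [Bc cft] cb] := bB (f t) b.
  by apply: open_nbhs_nbhs; split => //; rewrite Wb in Wt.
exists (f @^-1` c); first by split => //; exists c.
by move=> z cz; apply: WV; rewrite Wb; exact: cb.
Qed.

(** * Measurability of the system data, the controls and the likelihood *)

Section hybrid_measurability.
Variables (R : realType) (n : nat) (Q : pfinType) (U : ptopologicalType)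
  (S : hybrid_system R n Q U).
Hypothesis U2 : @second_countable U.
Context d (T : measurableType d).
Implicit Types (x : T -> borel 'rV[R]_n) (u : T -> borel U).

(** Continuity of [sys_h] is known on [sys_X S] times [U] only, so the preimage of an open set is
    the trace of an open [V]. As [x t] stays in [sys_X S], pulling back [V] itself gives the same
    set. *)
Lemma measurable_sys_h x u :
  measurable_fun setT x -> measurable_fun setT u ->
  (forall t, sys_X S (x t)) ->
  measurable_fun setT (fun t => sys_h S (x t, u t) : borel 'rV[R]_n).
Proof.
move=> mx mu xX; apply: measurable_to_borel => O oO.
have := (continuousP _).1 (@sys_h_continuous _ _ _ _ S) _ oO.
move=> /open_subspaceP[V oV VO].
have -> : (fun t => sys_h S (x t, u t)) @^-1` O =
    (fun t => (x t, u t)) @^-1` V.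
  apply/seteqP; split => t /= Ot.
    have : (sys_h S @^-1` O `&` sys_X S `*` setT) (x t, u t).
      by split=> //; split=> //=; exact: xX.
    by rewrite -VO => -[].
  have : (V `&` sys_X S `*` setT) (x t, u t).
      by split=> //; split=> //=; exact: xX.
  by rewrite VO => -[].
have mV := @open_setX_measurable _ (borel 'rV[R]_n) _ (borel U) _ _ id id
  (@rV_second_countable R n) U2 (@open_borel _) (@open_borel U) V oV.
rewrite -[X in measurable X]setTI.
exact: (measurable_fun_pair mx mu measurableT mV).
Qed.

Lemma measurable_discrete (a : T -> discrete Q) (A : set Q) :
  measurable_fun setT a -> measurable (a @^-1` A).
Proof.
by move=> ma; rewrite -[X in measurable X]setTI; apply: ma => //; exact: sub_sigma_algebra.
Qed.

(** [Q] being finite, the entry selected by [a] and [b] is a finite sum of indicators of their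
    values times the entries [sys_Qobs S q m], measurable in the control. *)
Lemma measurable_sys_Qobs (a b : T -> discrete Q) u :
  measurable_fun setT a -> measurable_fun setT b -> measurable_fun setT u ->
  measurable_fun setT (fun t => sys_Qobs S (a t) (b t) (u t)).
Proof.
move=> ma mb mu.
rewrite (_ : (fun t => _) = (fun t => \sum_(q : Q) \sum_(m : Q)
  \1_(a @^-1` [set q]) t * \1_(b @^-1` [set m]) t * sys_Qobs S q m (u t))).
  apply: measurable_sum => q; apply: measurable_sum => m.
  apply: measurable_funM; last by apply: measurableT_comp (sys_Qobs_measurable S q m) mu.
  apply: measurable_funM; apply: measurable_indic; exact: measurable_discrete.
apply/funext => t; rewrite (bigD1 (a t))//= (bigD1 (b t))//= !big1 ?addr0.
- by rewrite !indicE !mem_set// !mul1r.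
- move=> q qa; rewrite big1// => m _; rewrite indicE memNset ?mul0r//=.
  by move=> /esym/eqP; rewrite (negPf qa).
- move=> m mb'; rewrite [X in _ * X * _]indicE memNset ?mulr0 ?mul0r//=.
  by move=> /esym/eqP; rewrite (negPf mb').
Qed.

End hybrid_measurability.

Lemma measurable_funV d (T : measurableType d) (R : realType) (f : T -> R) :
  measurable_fun setT f -> (forall t, 0 <= f t) ->
  measurable_fun setT (fun t => (f t)^-1).
Proof.
move=> mf f0; rewrite (_ : (fun _ => _) = (@powR R ^~ (-1)) \o f).
  by apply: measurableT_comp => //; exact: measurable_powR.
by apply/funext => t /=; rewrite powR_inv1.
Qed.

Section closed_loop_measurability.
Variables (R : realType) (n : nat) (Q : pfinType) (U : ptopologicalType)
  (S : hybrid_system R n Q U).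
Local Notation Rn := (borel 'rV[R]_n).
Local Notation DQ := (discrete Q).
Local Notation BU := (borel U).
Context d (T : measurableType d) (s y : nat -> T -> Rn * DQ) (u : nat -> T -> BU).

(** Strong induction on time: the information at time [j] contains only earlier controls and the
    observations up to time [j]. The sigma-algebra of [T] is arbitrary, so that it can be a
    history. *)
Lemma measurable_control (mu : forall k, k.-tuple (Rn * DQ) * k.-tuple BU -> BU) l :
  (forall j, (j <= l)%N -> measurable_fun setT (mu j)) ->
  (forall j w, (j <= l)%N -> u j w = mu j (information y u j w)) ->
  (forall j, (1 <= j <= l)%N -> measurable_fun setT (y j)) ->
  forall j, (j <= l)%N -> measurable_fun setT (u j).
Proof.
move=> mmu uE my; elim/ltn_ind => j IH jl.
have -> : u j = mu j \o information y u j by apply/funext => w; rewrite uE.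
apply: measurableT_comp; first exact: mmu.
apply: measurable_fun_pair; apply/measurable_fun_tnthP => i.
- rewrite (_ : _ \o _ = y i.+1); last first.
    by apply/funext => w /=; rewrite tnth_mktuple.
  by apply: my; rewrite (leq_trans (ltn_ord i)).
- rewrite (_ : _ \o _ = u i); last first.
    by apply/funext => w /=; rewrite tnth_mktuple.
  by apply: IH => //; rewrite (leq_trans (ltnW (ltn_ord i))).
Qed.

Lemma likelihoodS k w : likelihood s y u S k.+1 w = likelihood s y u S k w *
  ((sys_phi S ((y k.+1 w).1 - sys_h S ((s k.+1 w).1, u k w) : 'rV[R]_n) *
    sys_Qobs S (s k.+1 w).2 (y k.+1 w).2 (u k w)) /
   (sys_phi S (y k.+1 w).1 * #|Q|%:R^-1)).
Proof. by rewrite /likelihood big_nat_recr. Qed.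

Lemma card_pfin_gt0 : 0 < #|Q|%:R :> R.
Proof. by rewrite ltr0n; apply/card_gt0P; exists (point : Q). Qed.

Lemma likelihood_gt0 k w : 0 < likelihood s y u S k w.
Proof.
apply: prodr_gt0 => l _; rewrite divr_gt0 ?mulr_gt0 ?sys_phi_gt0 ?sys_Qobs_gt0//.
by rewrite invr_gt0 card_pfin_gt0.
Qed.

Lemma measurable_likelihood k : @second_countable U ->
  (forall j, (1 <= j <= k)%N -> measurable_fun setT (s j)) ->
  (forall j, (1 <= j <= k)%N -> measurable_fun setT (y j)) ->
  (forall j, (j < k)%N -> measurable_fun setT (u j)) ->
  (forall j w, (1 <= j <= k)%N -> sys_X S (s j w).1) ->
  measurable_fun setT (likelihood s y u S k).
Proof.
move=> U2; elim: k => [|k IH] ms my mu sX.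
  rewrite (_ : likelihood _ _ _ _ _ = cst 1)//.
  by apply/funext => w; rewrite /likelihood big_geq.
rewrite (funext (likelihoodS k)); apply: measurable_funM.
  apply: IH.
  - by move=> j /andP[j0 jk]; apply: ms; rewrite j0 ltnW.
  - by move=> j /andP[j0 jk]; apply: my; rewrite j0 ltnW.
  - by move=> j jk; apply: mu; rewrite ltnW.
  - by move=> j w /andP[j0 jk]; apply: sX; rewrite j0 ltnW.
have kk : (1 <= k.+1 <= k.+1)%N by rewrite leqnn.
have msk := ms _ kk; have myk := my _ kk; have muk := mu k (leqnn _).
have mphi := @sys_phi_measurable _ _ _ _ S.
apply: measurable_funM; first apply: measurable_funM.
- apply: (measurableT_comp mphi).
  apply: (@measurable_subrV _ _ _ _ (fun w => (y k.+1 w).1)).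
    exact: measurableT_comp.
  apply: measurable_sys_h => //; first exact: measurableT_comp.
  by move=> t; exact: sX.
- by apply: measurable_sys_Qobs => //; exact: measurableT_comp.
- apply: measurable_funV.
    apply: measurable_funM => //; apply: (measurableT_comp mphi).
    exact: measurableT_comp.
  by move=> w; rewrite mulr_ge0 ?invr_ge0 ?ler0n// ltW// sys_phi_gt0.
Qed.

End closed_loop_measurability.

(** * Histories as sigma-algebras on the sample space *)

Section history.
Variables (R : realType) (n : nat) (Q : pfinType).
Context d (Omega : measurableType d)
  (s y : nat -> Omega -> borel 'rV[R]_n * discrete Q).

(** These are the generators appearing in [history], so that being measurable in [history_space k l]
    and belonging to [history s y k l] are convertible. *)
Definition history_gens k l : set (set Omega) :=
  [set E | (exists j B, [/\ (j <= k)%N, measurable B & E = s j @^-1` B]) \/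
           (exists j B, [/\ (1 <= j <= l)%N, measurable B & E = y j @^-1` B])].

(* A copy of Omega carrying the history as its sigma-algebra, so that being
   measurable with respect to the past is being measurable on this type. *)
Definition history_space k l := g_sigma_algebraType (history_gens k l).

HB.instance Definition _ k l := Measurable.copy (history_space k l)
  (g_sigma_algebraType (history_gens k l)).

(** Only the sigma-algebra changes: measurability of this identity map says that the history is
    contained in the sigma-algebra of [Omega]. *)
Definition to_history k l (w : Omega) : history_space k l := w.

Lemma history_subset k k' l l' : (k <= k')%N -> (l <= l')%N ->
  history s y k l `<=` history s y k' l'.
Proof.
move=> kk' ll'; apply: (@sub_sigma_algebra2 _ _ (history_gens k' l')) => E.
move=> [[j [B [jk mB ->]]]|[j [B [/andP[j0 jl] mB ->]]]]; [left|right]; exists j, B.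
  by split=> //; exact: leq_trans kk'.
by split=> //; rewrite j0 (leq_trans jl).
Qed.

Lemma measurable_history_s k l j : (j <= k)%N ->
  measurable_fun setT (s j : history_space k l -> borel 'rV[R]_n * discrete Q).
Proof.
move=> jk _ B mB; rewrite setTI; apply: sub_sigma_algebra; left.
by exists j, B.
Qed.

Lemma measurable_history_y k l j : (1 <= j <= l)%N ->
  measurable_fun setT (y j : history_space k l -> borel 'rV[R]_n * discrete Q).
Proof.
move=> jk _ B mB; rewrite setTI; apply: sub_sigma_algebra; right.
by exists j, B.
Qed.

Lemma measurable_to_history k l :
  (forall j, (j <= k)%N -> measurable_fun setT (s j)) ->
  (forall j, (1 <= j <= l)%N -> measurable_fun setT (y j)) ->
  measurable_fun setT (to_history k l).
Proof.
move=> ms my.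
apply: (@measurability _ _ Omega (history_space k l) setT _ (history_gens k l)) => //.
move=> _ [_ [[j [B [jk mB ->]]]|[j [B [jl mB ->]]]] <-].
- exact: ms.
- exact: my.
Qed.

End history.

(** * Law of the next observation under the reference measure *)

Section reference_measure.
Variables (R : realType) (n : nat) (Q : pfinType) (U : ptopologicalType)
  (S : hybrid_system R n Q U) (N : nat).
Local Notation Rn := (borel 'rV[R]_n).
Local Notation DQ := (discrete Q).
Local Notation BU := (borel U).
Variables (mu : forall k, k.-tuple (Rn * DQ) * k.-tuple BU -> BU).
Arguments mu : clear implicits.
Context d (Omega : measurableType d).
Variables (s y : nat -> Omega -> Rn * DQ) (u : nat -> Omega -> BU)
  (v : nat -> Omega -> Rn) (P Pd : probability Omega R).
Hypotheses (U2 : @second_countable U)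
  (mmu : forall k, (k < N)%N -> measurable_fun setT (mu k))
  (loop : closed_loop s y u S N mu v P)
  (change : change_of_measure s y u S N P Pd).

Local Notation H := (history_space s y).
Local Notation toH := (@to_history R n Q d Omega s y).
Local Notation lik := (likelihood s y u S).

Let mtoH k l : (k <= N)%N -> (l <= N)%N -> measurable_fun setT (toH k l).
Proof.
move=> kN lN; apply: measurable_to_history => j.
  by move=> jk; apply: loop_s_measurable loop _ (leq_trans jk kN).
move=> /andP[j0 jl]; apply: (loop_y_measurable loop).
by rewrite j0 (leq_trans jl).
Qed.

(** A control depends on the states only through the observations, whence a bound by [l] and none by
    [k]. *)
Let mu_H k l j : (j <= l)%N -> (j < N)%N -> measurable_fun setT (u j : H k l -> BU).
Proof.
move=> jl jN; apply: (@measurable_control R n Q U _ (H k l) y u mu j) => //.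
- by move=> i ij; apply: mmu; exact: leq_ltn_trans jN.
- by move=> i w ij; apply: (loop_control loop); exact: leq_ltn_trans jN.
- move=> i /andP[i0 ij]; apply: measurable_history_y.
  by rewrite i0 (leq_trans ij).
Qed.

Let mlik_H k k' l : (k <= k')%N -> (k <= l)%N -> (k' <= N)%N -> (l <= N)%N ->
  measurable_fun setT (lik k : H k' l -> R).
Proof.
move=> kk' kl kN lN.
apply: (@measurable_likelihood _ _ _ _ S _ (H k' l) s y u k) => //.
- by move=> j /andP[_ jk]; apply: measurable_history_s; exact: leq_trans kk'.
- move=> j /andP[j0 jk]; apply: measurable_history_y.
  by rewrite j0 (leq_trans jk).
- move=> j jk; apply: mu_H; first exact: leq_trans (ltnW jk) kl.
  exact: leq_trans jk (leq_trans kl lN).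
- move=> j w /andP[_ jk]; apply: (loop_s_in_X loop).
  by rewrite (leq_trans jk)// (leq_trans kk').
Qed.

(** The change of measure, extended from events to integrals, is applied to [G] divided by the
    likelihood, and the positive likelihood cancels. [G] has to be measurable for the history up to
    time [k], where the density is prescribed. *)
Lemma reference_integral k (G : Omega -> \bar R) : (k <= N)%N ->
  measurable_fun setT (G : H k k -> \bar R) -> (forall w, (0 <= G w)%E) ->
  (\int[Pd]_w G w = \int[P]_w (G w * ((lik k w)^-1)%:E))%E.
Proof.
move=> kN mG G0.
have mL : measurable_fun setT (fun w : H k k => (lik k w)^-1).
  apply: (@measurable_funV _ (H k k)); first exact: mlik_H.
  by move=> w; exact/ltW/likelihood_gt0.
have := @ge0_integral_density _ _ _ Omega Omega (H k k) R P Pd setT (toH k k)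
  (toH k k) (lik k) measurableT (mtoH kN kN) (mtoH kN kN) _ _ _
  (fun w => G w * ((lik k w)^-1)%:E)%E.
move=> ->//.
- apply: eq_integral => w _.
  by rewrite -muleA -EFinM mulVf ?mule1// gt_eqF// likelihood_gt0.
- exact: (measurableT_comp (mlik_H (leqnn k) (leqnn k) kN kN) (mtoH kN kN)).
- by move=> w; exact/ltW/likelihood_gt0.
- by move=> A mA; rewrite setTI; exact: change.
- by apply: emeasurable_funM => //; exact/measurable_EFinP.
- by move=> w; rewrite mule_ge0// lee_fin invr_ge0 ltW// likelihood_gt0.
Qed.

Lemma observation_step k A C (m : Q) : (k < N)%N -> history s y k k A ->
  measurable C ->
  (Pd (A `&` ((fun w => (y k.+1 w).1) @^-1` C `&` [set w | (y k.+1 w).2 = m])) =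
   Pd A * (noise_law S C * (#|Q|%:R^-1)%:E))%E.
Proof.
move=> kN HA mC; have kN' := ltnW kN.
set Y := _ @^-1` C; set E := [set w | _]; pose B := A `&` (Y `&` E).
pose hx w : 'rV[R]_n := sys_h S ((s k.+1 w).1, u k w).
pose q w := sys_Qobs S (s k.+1 w).2 m (u k w).
pose phi := sys_phi S; pose c : R := #|Q|%:R^-1.
have phi_gt0 z : 0 < phi z by exact: sys_phi_gt0.
have q_gt0 w : 0 < q w by exact: sys_Qobs_gt0.
have c_gt0 : 0 < c by rewrite invr_gt0 card_pfin_gt0.
have mphi : measurable_fun setT phi by exact: sys_phi_measurable.
(* This past contains the next state but not the next observation; it is the conditioning
   sigma-algebra of [loop_noise]. *)
pose H' := H k.+1 k.
have HA' : measurable (A : set H') by apply: (history_subset (leqnSn k) (leqnn k)).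
have msH : measurable_fun setT (s k.+1 : H' -> Rn * DQ) by exact: measurable_history_s.
have muH : measurable_fun setT (u k : H' -> BU) by exact: mu_H.
have mhx : measurable_fun setT (hx : H' -> Rn).
  apply: (@measurable_sys_h _ _ _ _ S U2 _ H') => //.
    exact: measurableT_comp.
  by move=> t; exact: (loop_s_in_X loop).
have mq : measurable_fun setT (q : H' -> R).
  apply: (@measurable_sys_Qobs _ _ _ _ S _ H' (fun w => (s k.+1 w).2) (fun=> m)) => //.
  exact: measurableT_comp.
have mlikV : measurable_fun setT (fun w : H' => (lik k w)^-1).
  apply: (@measurable_funV _ H'); first exact: mlik_H.
  by move=> w; exact/ltW/likelihood_gt0.
(* On [E], this is the indicator of [B] divided by the likelihood at time [k.+1], with the next
   observation rewritten as [hx] plus the noise [p.2]. The last factor inverts the last likelihood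
   ratio. *)
pose F (p : H' * Rn) : R :=
  \1_(A : set H') p.1 * \1_C (hx p.1 + (p.2 : 'rV[R]_n) : Rn) *
  (lik k p.1)^-1 *
  (phi (hx p.1 + (p.2 : 'rV[R]_n) : Rn) * c / (phi p.2 * q p.1)).
have mhz : measurable_fun setT (fun p : H' * Rn => hx p.1 + (p.2 : 'rV[R]_n) : Rn).
  apply: (@measurable_addrV R n _ (H' * Rn)%type (fun p => hx p.1) snd) => //.
  exact: (measurableT_comp mhx).
have mF : measurable_fun setT F.
  apply: measurable_funM; first apply: measurable_funM; first apply: measurable_funM.
  - by apply: (measurableT_comp (f := \1_(A : set H') : H' -> R)).
  - by apply: (measurableT_comp (f := \1_C : Rn -> R)).
  - exact: (measurableT_comp mlikV).
  - apply: measurable_funM.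
      by apply: measurable_funM => //; exact: (measurableT_comp mphi).
    apply: measurable_funV.
      apply: measurable_funM; first exact: (measurableT_comp mphi).
      exact: (measurableT_comp mq).
    by move=> p; rewrite mulr_ge0// ltW.
have F0 p : 0 <= F p.
  have L0 : 0 <= (lik k p.1)^-1 by rewrite invr_ge0 ltW// likelihood_gt0.
  rewrite /F; apply: mulr_ge0; first by rewrite !mulr_ge0.
  by rewrite divr_ge0// mulr_ge0// ltW.
have HB : measurable (B : set (H k.+1 k.+1)).
  have myH : measurable_fun setT (y k.+1 : H k.+1 k.+1 -> Rn * DQ).
    by apply: measurable_history_y; rewrite leqnn.
  apply: measurableI; first exact: (history_subset (leqnSn k) (leqnSn k)).
  apply: measurableI.
    rewrite -[X in measurable X]setTI.
    by apply: (measurableT_comp measurable_fst myH).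
  apply: (@measurable_discrete _ _ (H k.+1 k.+1) (fun w => (y k.+1 w).2) [set m]).
  exact: (measurableT_comp measurable_snd myH).
have mE : measurable E.
  apply: (@measurable_discrete _ _ Omega (fun w => (y k.+1 w).2) [set m]).
  apply: (measurableT_comp measurable_snd).
  by apply: (loop_y_measurable loop); rewrite ltnS leq0n.
have mB : measurable B.
  by rewrite -[X in measurable X]setTI; exact: (mtoH kN kN measurableT HB).
have mA : measurable A.
  by rewrite -[X in measurable X]setTI; exact: (mtoH kN' kN' measurableT HA).
(* [B] belongs to the history up to time [k.+1], so [reference_integral] applies at that time.
   Outside [E] the indicator of [B] vanishes. *)
have -> : (Pd B = \int[P]_(w in E) (F (toH k.+1 k w, v k.+1 w))%:E)%E.
  transitivity (\int[Pd]_w (\1_B w)%:E)%E; first by rewrite integral_indic// setIT.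
  rewrite (reference_integral kN)//; last first.
  - exact: ((@measurable_EFinP _ (H k.+1 k.+1) R setT (\1_B)).2
      (@measurable_indic _ (H k.+1 k.+1) R setT B HB)).
  rewrite [RHS]integral_mkcond; apply: eq_integral => w _; rewrite patchE.
  have yE : (y k.+1 w).1 = hx w + (v k.+1 w : 'rV[R]_n) by exact: (loop_obs_x loop).
  case: ifPn => wE; last first.
    rewrite indicE memNset ?mul0e//= => -[_ [_ Ew]].
    by move: wE; rewrite notin_setE; exact.
  move: (wE); rewrite inE => yqE.
  have -> : \1_B w = \1_A w * \1_C (hx w + (v k.+1 w : 'rV[R]_n) : Rn) :> R.
    by rewrite -yE !indicE /B !in_setI wE andbT -natrM mulnb.
  (* Subtracting [hx] from the observation leaves the noise, so the numerator of the ratio is [phi]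
     of the noise times [q]. *)
  rewrite /F /= -EFinM likelihoodS yE yqE (addrAC (hx w)) subrr add0r; congr EFin.
  by rewrite invfM invf_div mulrA.
rewrite (@integral_disintegration _ _ _ Omega H' Rn R P (lebesgue_rV R n) (toH k.+1 k)
  (v k.+1) E q phi (mtoH kN kN') _ mE _ mphi _ _ _ (EFin \o F))//.
- pose g (z : Rn) : R := \1_C z * phi z.
  have mg : measurable_fun setT g by exact: measurable_funM.
  have g0 z : 0 <= g z by rewrite mulr_ge0// ltW.
  have gE : (\int[lebesgue_rV R n]_z (g z)%:E)%E = noise_law S C.
    rewrite /noise_law [RHS]integral_mkcond; apply: eq_integral => z _.
    by rewrite patchE /g indicE; case: ifPn => _; rewrite ?mul1r ?mul0r.
  have noise0 : (0 <= noise_law S C * c%:E)%E.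
    by rewrite -gE mule_ge0 ?integral_ge0 ?lee_fin ?ltW// => z _; rewrite lee_fin.
  have invL0 w : 0 <= (lik k w)^-1 by rewrite invr_ge0 ltW// likelihood_gt0.
  transitivity (\int[P]_w ((\1_A w)%:E * ((lik k w)^-1)%:E *
      (noise_law S C * c%:E)))%E.
    apply: eq_integral => w _.
    (* The density [phi z * q w] cancels the denominator of [F]. The rest depends on [z] only
       through [hx w + z], and translation invariance then removes [hx w]. *)
    transitivity (\int[lebesgue_rV R n]_z ((\1_A w / lik k w * c)%:E *
        (g (hx w + (z : 'rV[R]_n)))%:E))%E.
      apply: eq_integral => z _; rewrite -!EFinM /F /g /=; congr EFin.
      rewrite /to_history -[LHS]mulrA divfK ?gt_eqF ?mulr_gt0// [X in X * _]mulrAC.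
      by rewrite (mulrC (phi _) c) mulrACA.
    rewrite ge0_integralZl//.
    - rewrite (@ge0_integral_shift R n (hx w) (EFin \o g))//.
      + by rewrite gE !EFinM -[LHS]muleA (muleC c%:E).
      + exact/measurable_EFinP.
    - apply/measurable_EFinP/(measurableT_comp mg).
      exact: (@measurable_addrV _ _ _ _ (fun=> hx w) id).
    - by move=> z _; rewrite lee_fin.
    - by rewrite lee_fin !mulr_ge0// ltW.
  rewrite ge0_integralZr//.
  + congr (_ * _)%E.
    (* The constant being factored out, the integral of the indicator of [A] over the likelihood at
       time [k] is read backwards as [Pd A]. *)
    rewrite -(@reference_integral k (EFin \o \1_A))//.
    - by rewrite integral_indic ?setIT.
    - exact: ((@measurable_EFinP _ (H k k) R setT (\1_A)).2
        (@measurable_indic _ (H k k) R setT A HA)).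
    - by move=> w; rewrite lee_fin.
  + apply: emeasurable_funM; apply/measurable_EFinP.
      by apply: measurable_indic.
    exact: (measurableT_comp (f := fun w : H' => (lik k w)^-1) mlikV (mtoH kN kN')).
  + by move=> w _; rewrite mule_ge0// lee_fin.
- by apply: (loop_v_measurable loop).
- exact: (measurableT_comp (f := q : H' -> R) mq (mtoH kN kN')).
- by move=> w; exact: ltW.
- by move=> z; exact: ltW.
- by move=> A' C' mA' mC'; exact: (loop_noise loop).
- exact/measurable_EFinP.
Qed.

End reference_measure.

(** * From one-step factorization to independent, identically distributed variables *)

Section independence_from_steps.
Local Open Scope ereal_scope.
Context d d' (Omega : measurableType d) (T : measurableType d') (R : realType).
Variables (P : probability Omega R) (Y : nat -> Omega -> T)
  (law : set T -> \bar R) (N : nat).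
Hypothesis step : forall k B, (k < N)%N -> (forall i, measurable (B i)) ->
  P ((\bigcap_(i in [set i | (1 <= i <= k)%N]) (Y i @^-1` B i)) `&`
     Y k.+1 @^-1` B k.+1) =
  P (\bigcap_(i in [set i | (1 <= i <= k)%N]) (Y i @^-1` B i)) * law (B k.+1).

Let marginal i B : (1 <= i <= N)%N -> measurable B -> P (Y i @^-1` B) = law B.
Proof.
case: i => // k /= kN mB.
(* Leaving all times but [k.+1] unconstrained makes the past event the whole space. *)
have /= := @step k (fun j => if j == k.+1 then B else setT) kN.
rewrite eqxx (_ : \bigcap_(_ in _) _ = setT).
  by rewrite setTI probability_setT mul1e; apply => j; case: ifPn.
apply/seteqP; split => // w _ j /= /andP[_ jk].
by rewrite ifF// ltn_eqF// ltnS.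
Qed.

Let joint k B : (k <= N)%N -> (forall i, measurable (B i)) ->
  P (\bigcap_(i in [set i | (1 <= i <= k)%N]) (Y i @^-1` B i)) =
  \prod_(1 <= i < k.+1) law (B i).
Proof.
move=> + mB; elim: k => [_|k IH kN].
  rewrite big_geq// -(@probability_setT _ _ _ P); congr (P _).
  by apply/seteqP; split => // w _ [].
rewrite (big_nat_recr k.+1)//= -(IH (ltnW kN)) -(step kN mB); congr (P _).
apply/seteqP; split => [w wB|w [wB wk] i /= /andP[i1]].
  split=> [i /= /andP[i1 ik]|]; apply: wB; rewrite /= ?ltnSn//.
  by rewrite i1 (leq_trans ik).
by rewrite leq_eqVlt => /predU1P[->//|ik]; apply: wB; rewrite /= i1.
Qed.

Lemma iid_with_law_steps : iid_with_law P [set k | (1 <= k <= N)%N] Y law.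
Proof.
split=> [J JN B mB|i iN B mB]; last exact: marginal.
(* Independence concerns any finite set [J] of times, while [joint] covers initial segments: the
   times outside [J] receive the full set. *)
pose B' i := if i \in J then B i else setT.
have mB' i : measurable (B' i) by rewrite /B'; case: ifP.
have -> : \bigcap_(i in [set` J]) (Y i @^-1` B i) =
    \bigcap_(i in [set i | (1 <= i <= N)%N]) (Y i @^-1` B' i).
  apply/seteqP; split => w wB i /= iJ.
    by rewrite /B'; case: ifPn => // /wB.
  by have := wB i (JN i iJ); rewrite /B' iJ.
rewrite joint// big_nat.
rewrite (eq_bigr (fun i => if i \in J then law (B i) else 1)); last first.
  move=> i; rewrite ltnS => iN; rewrite /B'; case: ifPn => // _.
  (* [law] is only a set function; its value 1 on [setT] comes from the marginal at time [i]. *)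
  by rewrite -(marginal iN)// preimage_setT probability_setT.
rewrite -big_mkcondr -[LHS]big_filter.
rewrite [RHS]big_seq [RHS](eq_bigr (law \o B)) => [|i iJ]; last first.
  exact: marginal (JN i iJ) (mB i).
(* As [J] is contained in the range from 1 to [N], filtering this range by [J] enumerates [J] up to
   order. *)
rewrite -big_seq; apply: perm_big; apply: uniq_perm.
- by rewrite filter_uniq// iota_uniq.
- exact: fset_uniq.
move=> i; rewrite mem_filter mem_index_iota.
apply/idP/idP => [/andP[/andP[_ ->]]//|iJ].
by have /= := JN i iJ; rewrite ltnS iJ andbT => ->.
Qed.

End independence_from_steps.

(** This recovers general events from [observation_step], which fixes one discrete value at a
    time. *)
Lemma measure_finType_fiber d (Omega : measurableType d) (R : realType)
    (P : {measure set Omega -> \bar R}) (Q : pfinType) (a : Omega -> discrete Q)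
    (X : set Omega) (C : set (discrete Q)) :
  measurable X -> measurable_fun setT a ->
  (P (X `&` a @^-1` C) =
   \sum_(m : Q | (m : discrete Q) \in C) P (X `&` [set w | a w = m]))%E.
Proof.
move=> mX ma.
have -> : X `&` a @^-1` C = \bigcup_(m in (C : set Q)) (X `&` [set w | a w = m]).
  apply/seteqP; split => w /=; first by move=> [Xw Cw]; exists (a w).
  by move=> [m Cm [Xw awm]]; split=> //; rewrite awm.
rewrite measure_fin_bigcup//.
- rewrite fsbig_mkcond (fsbigE (index_enum Q)) ?index_enum_uniq//; last first.
    by move=> m _; rewrite mem_index_enum.
  rewrite [RHS]big_mkcond /=; apply: eq_big => [m|m _]; first by rewrite in_setT.
  by rewrite patchE.
- exact: (@finite_finset Q).
- by move=> m m' _ _ [w [[_ /= <-] [_ /= <-]]].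
- move=> m _; apply: measurableI => //.
  exact: (@measurable_discrete _ _ Omega a [set m]).
Qed.

Section history_marginal.
Variables (R : realType) (n : nat) (Q : pfinType).
Context d d' (Omega : measurableType d) (T : measurableType d')
  (s y : nat -> Omega -> borel 'rV[R]_n * discrete Q)
  (f : borel 'rV[R]_n * discrete Q -> T).

(** With [f] the first or the second projection, this makes past events of either family of
    observations admissible in [observation_step]. *)
Lemma history_bigcap k (B : nat -> set T) :
  measurable_fun setT f -> (forall i, measurable (B i)) ->
  history s y k k (\bigcap_(i in [set i | (1 <= i <= k)%N])
    ((fun w => f (y i w)) @^-1` B i)).
Proof.
move=> mf mB.
apply: (@fin_bigcap_measurable _ (history_space s y k k)).
  by apply: (@sub_finite_set _ _ `I_k.+1) => // i /= /andP[_]; rewrite ltnS.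
move=> i ik; rewrite -[X in measurable X]setTI.
exact: (measurableT_comp mf (@measurable_history_y R n Q _ Omega s y k k i ik)).
Qed.

End history_marginal.

Theorem lemma5 (R : realType) (n : nat) (Q : pfinType) (U : ptopologicalType)
    (S : hybrid_system R n Q U) (N : nat)
    (mu : forall k, k.-tuple (borel 'rV[R]_n * discrete Q) * k.-tuple (borel U) ->
          borel U)
    (d : measure_display) (Omega : measurableType d)
    (s y : nat -> Omega -> borel 'rV[R]_n * discrete Q)
    (u : nat -> Omega -> borel U) (v : nat -> Omega -> borel 'rV[R]_n)
    (P Pd : probability Omega R) :
  compact [set: U] ->
  borel_space R U ->
  (forall k, (k < N)%N -> measurable_fun setT (mu k)) ->
  closed_loop s y u S N mu v P ->
  change_of_measure s y u S N P Pd ->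
  iid_with_law Pd [set k | (1 <= k <= N)%N]
    (fun k w => (y k w).1) (noise_law S) /\
  iid_with_law Pd [set k | (1 <= k <= N)%N]
    (fun k w => (y k w).2) (@uniform_law R Q).
Proof.
move=> _ /borel_space_second_countable U2 mmu loop change.
have obs k A C (m : Q) := @observation_step R n Q U S N mu d Omega s y u v P Pd
  U2 mmu loop change k A C m.
have noiseT : noise_law S setT = 1%E by exact: sys_phi_total.
have noise0 C : (0 <= noise_law S C)%E.
  by apply: integral_ge0 => z _; rewrite lee_fin ltW// sys_phi_gt0.
have c0 : 0 <= #|Q|%:R^-1 :> R by rewrite invr_ge0 ler0n.
have my1 k : (k < N)%N -> measurable_fun setT (y k.+1).
  by move=> kN; apply: (loop_y_measurable loop).
have mhist k A : (k < N)%N -> history s y k k A -> measurable A.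
  move=> kN HA; rewrite -[X in measurable X]setTI.
  have := @measurable_to_history R n Q d Omega s y k k; apply => // j.
    by move=> jk; apply: (loop_s_measurable loop); exact: leq_trans (ltnW kN).
  move=> /andP[j0 jk]; apply: (loop_y_measurable loop).
  by rewrite j0 (leq_trans jk (ltnW kN)).
split; apply: iid_with_law_steps => k B kN mB.
- have HA := @history_bigcap R n Q d _ Omega _ s y fst k B measurable_fst mB.
  set A := \bigcap_(_ in _) _ in HA *.
  have mY : measurable ((fun w => (y k.+1 w).1) @^-1` B k.+1).
    rewrite -[X in measurable X]setTI.
    by apply: (measurableT_comp measurable_fst (my1 _ kN)).
  (* A vacuous condition on the discrete observation is inserted and split over its values; the
     weights [#|Q|%:R^-1] then add up to 1. *)
  rewrite -[X in Pd X]setIT.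
  rewrite -[X in Pd (_ `&` X)](preimage_setT
    (fun w => (y k.+1 w).2 : discrete Q)).
  rewrite measure_finType_fiber; last 2 first.
  - by apply: measurableI => //; exact: mhist HA.
  - exact: (measurableT_comp measurable_snd (my1 _ kN)).
  rewrite (eq_bigr (fun=> Pd A * (noise_law S (B k.+1) * (#|Q|%:R^-1)%:E)))%E;
    last by move=> m _; rewrite -setIA; exact: obs.
  rewrite -ge0_sume_distrr; last by move=> m _; rewrite mule_ge0.
  rewrite -ge0_sume_distrr; last by move=> m _; rewrite lee_fin.
  congr (_ * _)%E; rewrite -[RHS]mule1; congr (_ * _)%E.
  rewrite (eq_bigl xpredT) => [|m]; last by rewrite in_setT.
  rewrite sumEFin sumr_const -[_ *+ _]mulr_natl; congr EFin; apply: mulfV.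
  by rewrite gt_eqF// card_pfin_gt0.
- have HA := @history_bigcap R n Q d _ Omega _ s y snd k B measurable_snd mB.
  set A := \bigcap_(_ in _) _ in HA *.
  rewrite measure_finType_fiber; last 2 first.
  - exact: mhist HA.
  - exact: (measurableT_comp measurable_snd (my1 _ kN)).
  rewrite /uniform_law ge0_sume_distrr//; apply: eq_bigr => m _.
  (* Here the condition on the continuous observation is the vacuous one: the factor 1 is written as
     the noise law of [setT]. *)
  rewrite -[X in _ = (_ * X)%E]mul1e -noiseT.
  by rewrite -(obs k A setT m kN HA measurableT) preimage_setT setTI.
Qed.
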